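(* Let $q\in\mathbb{R}^n$ and let $M_0,M_1,\dots,M_L\in\mathbb{R}^{n\times n}$ satisfy $\tfrac12(M_l+M_l^T)\succeq 0$ for $l=0,1,\dots,L$. For $u\in\mathbb{R}^L$ let $M(u)=M_0+\sum_{l=1}^Lu_lM_l$. Let $\mathcal{U}$ be one of $\mathcal{U}_\infty=\{u:\|u\|_\infty\le 1\}$, $\mathcal{U}_1=\{u:\|u\|_1\le 1\}$, $\mathcal{U}_2=\{u:\|u\|_2\le 1\}$ in $\mathbb{R}^L$. Consider the problem in $(x,t)\in\mathbb{R}^n\times\mathbb{R}$ $$\begin{array}{rl}\min & t\\ \text{subject to} & x^T(M(u)x+q)\le t,\quad\forall u\in\mathcal{U},\\ & M(u)x+q\ge 0,\quad\forall u\in\mathcal{U},\\ & x\ge 0.\end{array}$$ Then this problem admits a tractable robust counterpart.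
   Context: Vector inequalities are componentwise; $\succeq 0$ means symmetric positive semidefinite. Since $u$ may have negative components, $M(u)$ need not be positive semidefinite (in the sense $x^TM(u)x\ge0$ for all $x$) for every $u\in\mathcal{U}$. A tractable robust counterpart of the semi-infinite problem above is a single finite-dimensional convex optimization problem (finitely many real variables $(x,t,w)$, with $w$ a finite vector of additional variables; linear or convex quadratic objective; finitely many constraints, each an affine (in)equality, a convex quadratic inequality, a second-order cone constraint, or a linear matrix inequality) that is equivalent to it in the sense that, for every $x$ and $t$, the pair $(x,t)$ is feasible for the semi-infinite problem if and only if there is $w$ such that the corresponding point is feasible for the finite-dimensional convex problem with objective value at most $t$. *)

(* Defs.v *)
From mathcomp Require Import all_boot all_order all_algebra.
From mathcomp Require Import classical_sets reals topology normedtype.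
Set Implicit Arguments.
Unset Strict Implicit.
Unset Printing Implicit Defensive.
Import Order.TTheory GRing.Theory Num.Theory.
Import numFieldNormedType.Exports.
Local Open Scope classical_set_scope.
Local Open Scope ring_scope.

Section Vectors.
Context {R : realType}.

Definition dot {n} (a z : 'cV[R]_n) : R := (a^T *m z) 0 0.

Definition nonneg_vec {n} (v : 'cV[R]_n) : Prop := forall i, 0 <= v i 0.

Definition norm1 {n} (v : 'cV[R]_n) : R := \sum_i `|v i 0|.

Definition norm2 {n} (v : 'cV[R]_n) : R := Num.sqrt (\sum_i v i 0 ^+ 2).

(* On matrices, hence on column vectors, `|_| is the maximum norm. *)
Definition ball_oo L : set 'cV[R]_L := [set u | `|u| <= 1].
Definition ball_1 L : set 'cV[R]_L := [set u | norm1 u <= 1].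
Definition ball_2 L : set 'cV[R]_L := [set u | norm2 u <= 1].

Definition psd {n} (A : 'M[R]_n) : Prop :=
  A^T = A /\ forall x : 'cV[R]_n, 0 <= dot x (A *m x).

End Vectors.

Section ConvexProblem.
Context (R : realType).

(* The linear (affine) functions are those with cq_mx = 0. *)
Record convex_quadratic (N : nat) := ConvexQuadratic {
  cq_mx : 'M[R]_N;
  cq_vec : 'cV[R]_N;
  cq_cst : R;
  cq_psd : psd cq_mx }.

Definition cq_eval N (f : convex_quadratic N) (z : 'cV[R]_N) : R :=
  dot z (cq_mx f *m z) + dot (cq_vec f) z + cq_cst f.

Inductive convex_constraint (N : nat) : Type :=
| AffineEq (a : 'cV[R]_N) (b : R)
| AffineIneq (a : 'cV[R]_N) (b : R)
| QuadraticIneq (f : convex_quadratic N)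
| SecondOrderCone (m : nat) (A : 'M[R]_(m, N)) (b : 'cV[R]_m)
    (c : 'cV[R]_N) (d : R)
| LinearMatrixIneq (m : nat) (F0 : 'M[R]_m) (F : 'I_N -> 'M[R]_m)
    (F0_sym : F0^T = F0) (F_sym : forall i, (F i)^T = F i).

Definition satisfies N (z : 'cV[R]_N) (c : convex_constraint N) : Prop :=
  match c with
  | AffineEq a b => dot a z + b = 0
  | AffineIneq a b => dot a z + b <= 0
  | QuadraticIneq f => cq_eval f z <= 0
  | SecondOrderCone _ A b c d => norm2 (A *m z + b) <= dot c z + d
  | LinearMatrixIneq _ F0 F _ _ => psd (F0 + \sum_i z i 0 *: F i)
  end.

Record convex_problem (N : nat) := ConvexProblem {
  objective : convex_quadratic N;
  constraints : seq (convex_constraint N) }.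

Definition cp_feasible N (P : convex_problem N) (z : 'cV[R]_N) : Prop :=
  forall i : 'I_(size (constraints P)),
    satisfies z (tnth (in_tuple (constraints P)) i).

(* The variables (x, t, w), stacked in this order. *)
Definition stack n k (x : 'cV[R]_n) (t : R) (w : 'cV[R]_k)
  : 'cV[R]_(n + 1 + k) := col_mx (col_mx x t%:M) w.

(* S is the feasible set of a problem "min t s.t. (x, t) in S". *)
Definition tractable_robust_counterpart n k (S : 'cV[R]_n -> R -> Prop)
    (P : convex_problem (n + 1 + k)) : Prop :=
  forall (x : 'cV[R]_n) (t : R),
    S x t <-> exists w : 'cV[R]_k,
      cp_feasible P (stack x t w) /\ cq_eval (objective P) (stack x t w) <= t.

Definition admits_tractable_robust_counterpart n
    (S : 'cV[R]_n -> R -> Prop) : Prop :=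
  exists (k : nat) (P : convex_problem (n + 1 + k)),
    tractable_robust_counterpart S P.

End ConvexProblem.

Section UncertainLCP.
Context {R : realType} {n L : nat}.

(* M ord0 is the nominal matrix; M (lift ord0 l), the matrix of the l-th
   component of u. *)
Definition uncertain_mx (M : 'I_L.+1 -> 'M[R]_n) (u : 'cV[R]_L) : 'M[R]_n :=
  M ord0 + \sum_(l < L) u l 0 *: M (lift ord0 l).

Definition robust_feasible (M : 'I_L.+1 -> 'M[R]_n) (q : 'cV[R]_n)
    (U : set 'cV[R]_L) (x : 'cV[R]_n) (t : R) : Prop :=
  [/\ forall u, U u -> dot x (uncertain_mx M u *m x + q) <= t,
      forall u, U u -> nonneg_vec (uncertain_mx M u *m x + q)
    & nonneg_vec x].

End UncertainLCP.

(* Main.v *)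
(* Both families of semi-infinite constraints are affine in u, so the supremum
   over the ball is the dual norm of the vector of slopes. For the rows of
   M(u) x + q the slopes are linear in x, and the dual norm constraint is
   polyhedral or a second-order cone. For x^T (M(u) x + q) the slopes
   x^T M_l x are convex quadratic and nonnegative; as the dual norm is
   nondecreasing on the nonnegative orthant, they may be replaced by upper
   bounds, which leaves convex quadratic constraints even though M(u) itself
   need not be positive semidefinite. *)
Require Import Defs.
From mathcomp Require Import all_boot all_order all_algebra.
From mathcomp Require Import classical_sets reals topology normedtype.
From mathcomp Require Import ring lra.
Import Order.TTheory GRing.Theory Num.Theory.
Local Open Scope ring_scope.

(** * Bilinearity of the dot product and its values on basis vectors, rows and stacked vectors *)

Section DotProduct.
Context {R : realType}.

Lemma dotE {n} (a z : 'cV[R]_n) : dot a z = \sum_i a i 0 * z i 0.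
Proof. by rewrite /dot mxE; apply: eq_bigr => i _; rewrite mxE. Qed.

Lemma dotDr {n} (a y z : 'cV[R]_n) : dot a (y + z) = dot a y + dot a z.
Proof. by rewrite /dot mulmxDr mxE. Qed.

Lemma dotDl {n} (a b z : 'cV[R]_n) : dot (a + b) z = dot a z + dot b z.
Proof. by rewrite /dot linearD mulmxDl mxE. Qed.

Lemma dotZr {n} c (a z : 'cV[R]_n) : dot a (c *: z) = c * dot a z.
Proof. by rewrite /dot -scalemxAr mxE. Qed.

Lemma dotZl {n} c (a z : 'cV[R]_n) : dot (c *: a) z = c * dot a z.
Proof. by rewrite /dot linearZ -scalemxAl mxE. Qed.

Lemma dotNl {n} (a z : 'cV[R]_n) : dot (- a) z = - dot a z.
Proof. by rewrite -scaleN1r dotZl mulN1r. Qed.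

Lemma dotNr {n} (a z : 'cV[R]_n) : dot a (- z) = - dot a z.
Proof. by rewrite -scaleN1r dotZr mulN1r. Qed.

Lemma dot0l {n} (z : 'cV[R]_n) : dot 0 z = 0.
Proof. by rewrite /dot trmx0 mul0mx mxE. Qed.

Lemma dotC {n} (a z : 'cV[R]_n) : dot a z = dot z a.
Proof. by rewrite !dotE; apply: eq_bigr => i _; rewrite mulrC. Qed.

Lemma dot_sumr {n} (I : Type) (r : seq I) (P : pred I) (a : 'cV[R]_n) F :
  dot a (\sum_(i <- r | P i) F i) = \sum_(i <- r | P i) dot a (F i).
Proof. by rewrite /dot mulmx_sumr summxE. Qed.

Lemma dot_suml {n} (I : Type) (r : seq I) (P : pred I) (z : 'cV[R]_n) F :
  dot (\sum_(i <- r | P i) F i) z = \sum_(i <- r | P i) dot (F i) z.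
Proof. by rewrite dotC dot_sumr; apply: eq_bigr => i _; rewrite dotC. Qed.

Lemma dot_delta {n} (i : 'I_n) (z : 'cV[R]_n) : dot (delta_mx i 0) z = z i 0.
Proof.
rewrite dotE (bigD1 i) //= mxE !eqxx mul1r big1 ?addr0 // => j ji.
by rewrite mxE (negbTE ji) mul0r.
Qed.

Lemma dot_row {m n} (A : 'M[R]_(m, n)) i (x : 'cV[R]_n) :
  dot (row i A)^T x = (A *m x) i 0.
Proof. by rewrite /dot trmxK -row_mul mxE. Qed.

Lemma dot_stack {n k} (a : 'cV[R]_n) c (b : 'cV[R]_k) x t w :
  dot (stack a c b) (stack x t w) = dot a x + c * t + dot b w.
Proof.
by rewrite /dot /stack !tr_col_mx !mul_row_col tr_scalar_mx -scalar_mxM !mxE eqxx mulr1n.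
Qed.

End DotProduct.

(** * Support functions of the three unit balls *)

Section SupportFunctions.
Context {R : realType} {L : nat}.
Implicit Types (u b : 'cV[R]_L) (s : R).

(** The condition [0 <= s] matters for [L = 0], where there are no entries and the norm is 0. *)
Lemma mx_norm_leP b s :
  `|b| <= s <-> 0 <= s /\ forall l, `|b l 0| <= s.
Proof.
have -> : `|b| = \big[Num.max/0]_ij `|b ij.1 ij.2| by exact: mx_normrE.
split=> [bs | [s0 bs]].
  split=> [|l]; first by apply: le_trans bs; exact: bigmax_ge_id.
  by apply: le_trans bs; apply: (le_bigmax _ _ (l, 0)).
by apply: bigmax_le => // -[i j] _; rewrite /= (ord1 j).
Qed.

Lemma norm2_leP b s :
  norm2 b <= s <-> 0 <= s /\ \sum_l b l 0 ^+ 2 <= s ^+ 2.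
Proof.
have S0 : 0 <= \sum_l b l 0 ^+ 2 by apply: sumr_ge0 => l _; exact: sqr_ge0.
rewrite /norm2; split=> [bs | [s0 bs]].
  have s0 : 0 <= s by apply: le_trans bs; exact: sqrtr_ge0.
  by split=> //; rewrite -(sqr_sqrtr S0) lerXn2r ?nnegrE ?sqrtr_ge0.
by rewrite -(ger0_norm s0) -sqrtr_sqr ler_wsqrtr.
Qed.

Lemma ball_2P u : @ball_2 R L u <-> \sum_l u l 0 ^+ 2 <= 1.
Proof.
have := norm2_leP u 1; rewrite expr1n => -[uP Pu].
by split=> [/uP[]|u1] //; apply: Pu.
Qed.

(** The support function is described by its epigraph rather than as a supremum, so a constraint
    quantified over [U] can be rewritten directly. *)
Definition support_function (U : set 'cV[R]_L) (N : 'cV[R]_L -> R) : Prop :=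
  forall b s, (forall u, U u -> dot u b <= s) <-> N b <= s.

(** The maximum is attained at the vector of signs of [b]. *)
Lemma support_ball_oo : support_function (@ball_oo R L) norm1.
Proof.
move=> b s; split=> [bs | bs u /mx_norm_leP[_ u1]].
  have -> : norm1 b = dot (\col_l Num.sg (b l 0)) b.
    by rewrite dotE; apply: eq_bigr => l _; rewrite mxE normrEsg.
  apply/bs/mx_norm_leP; split=> // l.
  by rewrite mxE normr_sg lern1 leq_b1.
apply: le_trans bs; rewrite dotE; apply: ler_sum => l _.
apply: le_trans (ler_norm _) _.
by rewrite normrM ler_piMl.
Qed.

(** The maximum is attained at 0 or at a signed basis vector; conversely each term of [dot u b] is
    at most [s] times the absolute value of the entry of [u]. *)
Lemma support_ball_1 : support_function (@ball_1 R L) (fun b => `|b|).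
Proof.
move=> b s; split=> [bs | /mx_norm_leP[s0 bs] u u1].
  apply/mx_norm_leP; split=> [|l].
    (* The point [u = 0] gives [0 <= s] even when [L = 0]. *)
    have := bs 0; rewrite dot0l; apply.
    by rewrite /ball_1 /= /norm1 big1 // => i _; rewrite mxE normr0.
  have -> : `|b l 0| = dot (Num.sg (b l 0) *: delta_mx l 0) b.
    by rewrite dotZl dot_delta normrEsg.
  apply: bs; rewrite /ball_1 /= /norm1 (bigD1 l) //= big1 => [|i il].
    by rewrite !mxE !eqxx mulr1 addr0 normr_sg lern1 leq_b1.
  by rewrite !mxE (negbTE il) mulr0 normr0.
have {}u1 : norm1 u <= 1 by [].
have H : dot u b <= norm1 u * s.
  rewrite dotE /norm1 mulr_suml; apply: ler_sum => l _.
  apply: le_trans (ler_norm _) _.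
  by rewrite normrM ler_wpM2l.
by apply: le_trans H _; rewrite ler_piMl.
Qed.

Lemma support_ball_2 : support_function (@ball_2 R L) norm2.
Proof.
move=> b s; have N0 : 0 <= norm2 b by exact: sqrtr_ge0.
have Nsqr : \sum_l b l 0 ^+ 2 = norm2 b ^+ 2.
  by rewrite sqr_sqrtr //; apply: sumr_ge0 => l _; exact: sqr_ge0.
have dbb : dot b b = norm2 b ^+ 2.
  by rewrite dotE -Nsqr; apply: eq_bigr => l _; rewrite expr2.
(* The maximizer is [b] divided by its norm, so [b = 0] is treated apart. *)
have [bN0 | bN0] := eqVneq (norm2 b) 0.
  have b0 : b = 0.
    apply/matrixP => l j; rewrite (ord1 j) mxE; apply/eqP; rewrite -sqrf_eq0.
    move/eqP: Nsqr; rewrite bN0 expr0n /= psumr_eq0 => [/allP/(_ l)|i _].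
      by rewrite mem_index_enum; apply.
    exact: sqr_ge0.
  rewrite bN0; split=> [/(_ 0)|s0 u _]; last by rewrite b0 dotC dot0l.
  rewrite dot0l; apply; apply/ball_2P.
  by rewrite big1 // => i _; rewrite mxE expr0n.
have Npos : 0 < norm2 b by rewrite lt_def bN0.
split=> [bs | bs u /ball_2P u1].
  suff <- : dot ((norm2 b)^-1 *: b) b = norm2 b.
    apply/bs/ball_2P.
    under eq_bigr => l _ do rewrite mxE exprMn.
    by rewrite -mulr_sumr Nsqr -exprMn mulVf // expr1n.
  by rewrite dotZl dbb; field.
(* Cauchy-Schwarz: expand [0 <= dot z z] at [z = b - norm2 b *: u]. *)
apply: le_trans bs; rewrite -subr_ge0.
have : 0 <= dot (b - norm2 b *: u) (b - norm2 b *: u).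
  by rewrite dotE; apply: sumr_ge0 => l _; rewrite -expr2 sqr_ge0.
have duu : dot u u <= 1.
  by rewrite dotE; under eq_bigr => l _ do rewrite -expr2.
rewrite dotDl !dotDr !dotNl !dotNr !dotZl !dotZr dbb (dotC b u) => sq0.
(* Since [dot u u <= 1], the expanded square is at most twice this product. *)
have : 0 <= norm2 b * (norm2 b - dot u b) by nra.
by rewrite pmulr_rge0.
Qed.

Lemma ler_norm2 b (y : 'cV[R]_L) :
  (forall l, 0 <= b l 0 <= y l 0) -> norm2 b <= norm2 y.
Proof.
move=> by_; rewrite ler_wsqrtr //; apply: ler_sum => l _.
have /andP[b0 bl] := by_ l.
by rewrite lerXn2r ?nnegrE // (le_trans b0).
Qed.

End SupportFunctions.

(** * Convex constraints in the stacked variables [(x, t, w)] *)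

Section StackedConstraints.
Context {R : realType} {n : nat}.

(** Unlike [psd], this does not ask for symmetry, which the matrices [M l] may lack. *)
Definition monotone_mx (A : 'M[R]_n) : Prop := forall x, 0 <= dot x (A *m x).

(** A scalar equals its transpose, so [A] and its transpose have the same quadratic form. *)
Lemma dot_mulmx_sym (A : 'M[R]_n) x :
  dot x ((2^-1 *: (A + A^T)) *m x) = dot x (A *m x).
Proof.
have trA : dot x (A^T *m x) = dot x (A *m x).
  by rewrite dotC /dot trmx_mul trmxK mulmxA.
by rewrite -scalemxAl mulmxDl dotZr dotDr trA; field.
Qed.

Lemma monotone_mx0 : monotone_mx 0.
Proof. by move=> x; rewrite mul0mx dotC dot0l. Qed.

Lemma monotone_mxD {A B} :
  monotone_mx A -> monotone_mx B -> monotone_mx (A + B).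
Proof. by move=> hA hB x; rewrite mulmxDl dotDr addr_ge0. Qed.

Lemma monotone_mx_sum {I : finType} {F : I -> 'M[R]_n} :
  (forall i, monotone_mx (F i)) -> monotone_mx (\sum_i F i).
Proof.
by move=> hF x; rewrite mulmx_suml dot_sumr; apply: sumr_ge0 => i _; exact: hF.
Qed.

Context {k : nat}.
Implicit Types (x a : 'cV[R]_n) (t c d : R) (w b : 'cV[R]_k).

(** The matrix is symmetrized because [convex_quadratic] demands a symmetric one; the zero blocks
    reflect that [t] and [w] enter only linearly. *)
Definition stack_mx (A : 'M[R]_n) : 'M[R]_(n + 1 + k) :=
  block_mx (block_mx (2^-1 *: (A + A^T)) 0 0 0) 0 0 0.

Lemma dot_stack_mx (A : 'M[R]_n) x t w :
  dot (stack x t w) (stack_mx A *m stack x t w) = dot x (A *m x).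
Proof.
have -> : stack_mx A *m stack x t w = stack ((2^-1 *: (A + A^T)) *m x) 0 0.
  by rewrite /stack_mx /stack !mul_block_col !mul0mx !addr0 raddf0.
by rewrite dot_stack dot_mulmx_sym mulr0 (dotC w) dot0l !addr0.
Qed.

Lemma psd_stack_mx {A} : monotone_mx A -> psd (stack_mx A).
Proof.
move=> hA; split=> [|z].
  by rewrite /stack_mx !tr_block_mx !trmx0 linearZ linearD /= trmxK addrC.
have -> : z = stack (usubmx (usubmx z)) (dsubmx (usubmx z) 0 0) (dsubmx z).
  by rewrite /stack -mx11_scalar !vsubmxK.
by rewrite dot_stack_mx.
Qed.

Definition stack_quadratic {A} (hA : monotone_mx A) a c b d :=
  ConvexQuadratic (stack a c b) d (psd_stack_mx hA).

Lemma stack_quadraticE A (hA : monotone_mx A) a c b d x t w :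
  cq_eval (stack_quadratic hA a c b d) (stack x t w) =
  dot x (A *m x) + (dot a x + c * t + dot b w) + d.
Proof. by rewrite /cq_eval dot_stack_mx dot_stack. Qed.

Definition quad_le {A} (hA : monotone_mx A) a c b d :=
  QuadraticIneq (stack_quadratic hA a c b d).

Lemma quad_leP A (hA : monotone_mx A) a c b d x t w :
  satisfies (stack x t w) (quad_le hA a c b d) =
  (dot x (A *m x) + (dot a x + c * t + dot b w) + d <= 0).
Proof. by rewrite -stack_quadraticE. Qed.

Definition affine_le a c b d := AffineIneq (stack a c b) d.

Lemma affine_leP a c b d x t w :
  satisfies (stack x t w) (affine_le a c b d) =
  (dot a x + c * t + dot b w + d <= 0).
Proof. by rewrite -dot_stack. Qed.

Definition cone_le {m} (A : 'M[R]_(m, n)) (B : 'M[R]_(m, k)) a c b d :=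
  SecondOrderCone (row_mx (row_mx A 0) B) 0 (stack a c b) d.

Lemma cone_leP m (A : 'M[R]_(m, n)) (B : 'M[R]_(m, k)) a c b d x t w :
  satisfies (stack x t w) (cone_le A B a c b d) =
  (norm2 (A *m x + B *m w) <= dot a x + c * t + dot b w + d).
Proof. by rewrite /= dot_stack /stack !mul_row_col mul0mx !addr0. Qed.

(** Indexing the constraints by a finite type lets each family be a constructor, handled by case
    analysis. The objective is the coordinate [t], so its bound by [t] holds trivially. *)
Lemma admits_counterpart_family (S : 'cV[R]_n -> R -> Prop) (I : finType)
    (C : I -> convex_constraint R (n + 1 + k)) :
  (forall x t, S x t <-> exists w, forall i, satisfies (stack x t w) (C i)) ->
  admits_tractable_robust_counterpart S.
Proof.
move=> SC; exists k, (ConvexProblem (stack_quadratic monotone_mx0 0 1 0 0)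
  [seq C i | i <- enum I]).
have feasE z : cp_feasible (ConvexProblem (stack_quadratic monotone_mx0 0 1 0 0)
    [seq C i | i <- enum I]) z <-> forall i, satisfies z (C i).
  (* [enum_rank] and [enum_val] translate between indices in [I] and positions in the list. *)
  split=> [zC i|zC j].
    have si : (enum_rank i < size [seq C i | i <- enum I])%N.
      by rewrite size_map -cardE.
    have := zC (Ordinal si); rewrite (tnth_nth (C i)) /= (nth_map i).
      by rewrite nth_enum_rank.
    by rewrite -cardE.
  have sE : size [seq C i | i <- enum I] = #|I| by rewrite size_map -cardE.
  pose i : I := enum_val (cast_ord sE j).
  suff -> : tnth (in_tuple [seq C i | i <- enum I]) j = C i by [].
  rewrite (tnth_nth (C i)) /= (nth_map i); last by rewrite -cardE -sE.
  exact: esym (congr1 C (enum_val_nth i (cast_ord sE j))).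
move=> x t; rewrite SC; split=> -[w].
  move=> xtw; exists w; split; first exact/feasE.
  by rewrite stack_quadraticE mul0mx !(dotC x) !dot0l add0r mul1r !addr0 add0r.
by case=> /feasE xtw _; exists w.
Qed.

End StackedConstraints.

(** * Elimination of the uncertainty and the counterpart for each ball *)

Section RobustCounterpart.
Context {R : realType} {n L : nat} (q : 'cV[R]_n) (M : 'I_L.+1 -> 'M[R]_n).
Context (hM : forall l, monotone_mx (M l)).
Implicit Types (x : 'cV[R]_n) (t : R) (u : 'cV[R]_L).

Definition quad_slopes x : 'cV[R]_L :=
  \col_l dot x (M (lift ord0 l) *m x).

(** The rows numbered [i] of all the perturbation matrices are collected so that the slopes of
    component [i] are a linear image of [x], as a cone constraint requires. *)
Definition row_slopes i : 'M[R]_(L, n) := \matrix_(l, j) M (lift ord0 l) i j.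

Lemma quad_slopes_ge0 x l : 0 <= quad_slopes x l 0.
Proof. by rewrite mxE hM. Qed.

Lemma row_slopesE i x l :
  (row_slopes i *m x) l 0 = (M (lift ord0 l) *m x) i 0.
Proof. by rewrite !mxE; apply: eq_bigr => j _; rewrite !mxE. Qed.

Lemma uncertain_mxE u x :
  uncertain_mx M u *m x =
  M ord0 *m x + \sum_l u l 0 *: (M (lift ord0 l) *m x).
Proof.
rewrite /uncertain_mx mulmxDl mulmx_suml; congr (_ + _).
by apply: eq_bigr => l _; rewrite -scalemxAl.
Qed.

(** Both constraints are put in the form [dot u b <= s]. The row constraint bounds from below,
    whence the minus sign before [row_slopes]. *)
Lemma robust_feasibleE (U : set 'cV[R]_L) N (UN : support_function U N) x t :
  robust_feasible M q U x t <->
  [/\ N (quad_slopes x) <= t - dot x (M ord0 *m x + q),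
      forall i, N (- row_slopes i *m x) <= (M ord0 *m x + q) i 0
    & nonneg_vec x].
Proof.
have quadE u : dot x (uncertain_mx M u *m x + q) =
    dot u (quad_slopes x) + dot x (M ord0 *m x + q).
  rewrite uncertain_mxE addrAC dotDr [LHS]addrC dot_sumr [dot u _]dotE; congr (_ + _).
  by apply: eq_bigr => l _; rewrite dotZr mxE.
have rowE u i : (uncertain_mx M u *m x + q) i 0 =
    (M ord0 *m x + q) i 0 - dot u (- row_slopes i *m x).
  rewrite mulNmx dotNr opprK uncertain_mxE addrAC [LHS]mxE summxE dotE.
  by congr (_ + _); apply: eq_bigr => l _; rewrite row_slopesE mxE.
split=> -[h1 h2 h3]; split=> //.
- by apply/UN => u /h1; rewrite quadE lerBrDr.
- by move=> i; apply/UN => u /h2 /(_ i); rewrite rowE subr_ge0.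
- by move=> u Uu; rewrite quadE -lerBrDr; apply/UN: u Uu.
- by move=> u Uu i; rewrite rowE subr_ge0; apply/UN: u Uu.
Qed.

Lemma dot_quad_affine (A : 'M[R]_n) x :
  dot x (A *m x + q) = dot x (A *m x) + dot q x.
Proof. by rewrite dotDr (dotC x q). Qed.

(* The worst case of the quadratic constraint is [u = (1, ..., 1)]; the slack
   variables bound the absolute values of the slopes of the rows. *)
Lemma counterpart_ball_oo :
  admits_tractable_robust_counterpart (robust_feasible M q (@ball_oo R L)).
Proof.
(* The slacks form an [n] by [L] matrix flattened into [w]; [slack i l] selects one entry. *)
pose slack i l : 'cV[R]_(n * L) := delta_mx (mxvec_index i l) 0.
apply: (@admits_counterpart_family _ _ (n * L) _
  (unit + 'I_n + 'I_n + 'I_n * 'I_L * bool)%type (fun j => match j with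
  | inl (inl (inl _)) => quad_le (monotone_mx_sum hM) q (-1) 0 0
  | inl (inl (inr i)) => affine_le (- delta_mx i 0) 0 0 0
  | inl (inr i) =>
      affine_le (- (row i (M ord0))^T) 0 (\sum_l slack i l) (- q i 0)
  (* The sign [s] yields the two inequalities that bound an absolute value by its slack. *)
  | inr (i, l, s) =>
      affine_le ((-1) ^+ s *: (row i (M (lift ord0 l)))^T) 0 (- slack i l) 0
  end)) => x t.
(* The slopes are nonnegative, so their [norm1] is their plain sum. *)
have totalE : dot x ((\sum_l M l) *m x) =
    dot x (M ord0 *m x) + norm1 (quad_slopes x).
  rewrite big_ord_recl mulmxDl dotDr mulmx_suml dot_sumr; congr (_ + _).
  apply: eq_bigr => l _.
  by rewrite ger0_norm ?quad_slopes_ge0 // mxE.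
rewrite (robust_feasibleE _ _ support_ball_oo).
split=> [[hquad hrow x0] | [w hw]].
- exists (mxvec (\matrix_(i, l) `|(M (lift ord0 l) *m x) i 0|))^T.
  have slackE i l : dot (slack i l)
      (mxvec (\matrix_(i, l) `|(M (lift ord0 l) *m x) i 0|))^T =
      `|(M (lift ord0 l) *m x) i 0| by rewrite dot_delta mxE mxvecE mxE.
  case=> [[[_|i]|i]|[[i l] s]].
  + rewrite quad_leP totalE dot0l; move: hquad; rewrite dot_quad_affine; lra.
  + rewrite affine_leP dotNl dot_delta dot0l; have := x0 i; lra.
  + rewrite affine_leP dotNl dot_row dot_suml.
    have := hrow i; rewrite [(_ + q) i 0]mxE /norm1.
    under eq_bigr => l _ do rewrite mulNmx mxE row_slopesE normrN.
    under [in X in _ -> X]eq_bigr => l _ do rewrite slackE.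
    lra.
  + rewrite affine_leP dotZl dot_row dotNl slackE.
    have := ler_norm ((-1) ^+ s * (M (lift ord0 l) *m x) i 0).
    rewrite normrM normrX normrN1 expr1n mul1r; lra.
have slackP i l : `|(M (lift ord0 l) *m x) i 0| <= dot (slack i l) w.
  have := hw (inr (i, l, false)); have := hw (inr (i, l, true)).
  rewrite !affine_leP !dotZl dot_row dotNl expr0 expr1 ler_norml; lra.
split=> [|i|i].
- have := hw (inl (inl (inl tt))).
  rewrite quad_leP totalE dot0l dot_quad_affine; lra.
- have := hw (inl (inr i)); rewrite affine_leP dotNl dot_row dot_suml.
  have : norm1 (- row_slopes i *m x) <= \sum_l dot (slack i l) w.
    apply: ler_sum => l _.
    by rewrite mulNmx mxE row_slopesE normrN.
  rewrite [(_ + q) i 0]mxE; lra.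
- have := hw (inl (inl (inr i))); rewrite affine_leP dotNl dot_delta dot0l; lra.
Qed.

(** The max norm splits into finitely many bounds, so there are no slack variables. The rows are
    tested at 0 and at both signs of each basis vector; for the quadratic constraint the positive
    sign suffices, as the slopes are nonnegative. *)
Lemma counterpart_ball_1 :
  admits_tractable_robust_counterpart (robust_feasible M q (@ball_1 R L)).
Proof.
(* [None] stands for [u = 0] and [Some l] for the basis vector [l]. *)
have hN (o : option 'I_L) :
    monotone_mx (M ord0 + oapp (fun l => M (lift ord0 l)) 0 o).
  by apply: monotone_mxD => //; case: o => [l|] //=; exact: monotone_mx0.
apply: (@admits_counterpart_family _ _ 0 _
  (option 'I_L + 'I_n + 'I_n + 'I_n * 'I_L * bool)%type (fun j => match j with
  | inl (inl (inl o)) => quad_le (hN o) q (-1) 0 0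
  | inl (inl (inr i)) => affine_le (- delta_mx i 0) 0 0 0
  | inl (inr i) => affine_le (- (row i (M ord0))^T) 0 0 (- q i 0)
  | inr (i, l, s) => affine_le
      ((-1) ^+ s *: (row i (M (lift ord0 l)))^T - (row i (M ord0))^T) 0 0
      (- q i 0)
  end)) => x t.
rewrite (robust_feasibleE _ _ support_ball_1).
split=> [[/mx_norm_leP[hquad0 hquad] hrow x0] | [w hw]].
- exists 0; case=> [[[o|i]|i]|[[i l] s]].
  + rewrite quad_leP mulmxDl dotDr dot0l; case: o => [l|] /=.
      have := le_trans (ler_norm _) (hquad l).
      rewrite mxE dot_quad_affine; lra.
    by move: hquad0; rewrite dot_quad_affine mul0mx (dotC x 0) dot0l; lra.
  + rewrite affine_leP dotNl dot_delta dot0l; have := x0 i; lra.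
  + have /mx_norm_leP[] := hrow i.
    rewrite affine_leP dotNl dot_row dot0l [(_ + q) i 0]mxE; lra.
  + have /mx_norm_leP[_ /(_ l)] := hrow i.
    rewrite affine_leP dotDl dotZl dotNl !dot_row dot0l [(_ + q) i 0]mxE.
    rewrite mulNmx mxE row_slopesE normrN.
    have := ler_norm ((-1) ^+ s * (M (lift ord0 l) *m x) i 0).
    rewrite normrM normrX normrN1 expr1n mul1r; lra.
split=> [|i|i].
- apply/mx_norm_leP; split=> [|l].
    have := hw (inl (inl (inl None))).
    rewrite quad_leP /= !addr0 dot0l dot_quad_affine; lra.
  have := hw (inl (inl (inl (Some l)))).
  rewrite quad_leP mulmxDl dotDr dot0l dot_quad_affine.
  rewrite ger0_norm ?quad_slopes_ge0 // mxE /=; lra.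
- apply/mx_norm_leP; split=> [|l].
    have := hw (inl (inr i)).
    rewrite affine_leP dotNl dot_row dot0l [(_ + q) i 0]mxE; lra.
  have := hw (inr (i, l, false)); have := hw (inr (i, l, true)).
  rewrite !affine_leP !dotDl !dotZl !dotNl !dot_row dot0l expr0 expr1.
  rewrite [(_ + q) i 0]mxE mulNmx [in X in _ -> _ -> X]mxE row_slopesE normrN ler_norml.
  lra.
- have := hw (inl (inl (inr i))); rewrite affine_leP dotNl dot_delta dot0l; lra.
Qed.

(* The slack variables are an upper bound of [dot x (M ord0 *m x + q)], then
   upper bounds of the slopes. *)
Lemma counterpart_ball_2 :
  admits_tractable_robust_counterpart (robust_feasible M q (@ball_2 R L)).
Proof.
(* A cone constraint needs an affine right-hand side, so the quadratic nominal value is moved to the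
   slack selected by [s0], leaving [t] minus that slack. *)
pose s0 : 'cV[R]_(1 + L) := delta_mx (lshift L 0) 0.
pose slack l : 'cV[R]_(1 + L) := delta_mx (rshift 1 l) 0.
apply: (@admits_counterpart_family _ _ (1 + L) _
  (unit + 'I_L + unit + 'I_n + 'I_n)%type (fun j => match j with
  | inl (inl (inl (inl _))) => quad_le (hM ord0) q 0 (- s0) 0
  | inl (inl (inl (inr l))) => quad_le (hM (lift ord0 l)) 0 0 (- slack l) 0
  | inl (inl (inr _)) => cone_le 0 (row_mx 0 1%:M) 0 1 (- s0) 0
  | inl (inr i) => affine_le (- delta_mx i 0) 0 0 0
  | inr i => cone_le (- row_slopes i) 0 (row i (M ord0))^T 0 0 (q i 0)
  end)) => x t.
rewrite (robust_feasibleE _ _ support_ball_2).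
have s0E s y : dot s0 (col_mx s%:M y) = s.
  by rewrite dot_delta col_mxEu mxE eqxx.
have slackE s y l : dot (slack l) (col_mx s%:M y) = y l 0.
  by rewrite dot_delta col_mxEd.
split=> [[hquad hrow x0] | [w hw]].
(* Each slack is given the exact value that it has to bound. *)
- exists (col_mx (dot x (M ord0 *m x + q))%:M (quad_slopes x)).
  case=> [[[[_|l]|_]|i]|i].
  + rewrite quad_leP dotNl s0E dot_quad_affine; lra.
  + rewrite quad_leP dotNl slackE dot0l mxE; lra.
  + rewrite cone_leP !mul0mx add0r mul_row_col mul0mx mul1mx add0r.
    rewrite dotNl s0E dot0l; lra.
  + rewrite affine_leP dotNl dot_delta dot0l; have := x0 i; lra.
  + rewrite cone_leP mul0mx addr0 dot_row dot0l.
    have := hrow i; rewrite [(_ + q) i 0]mxE; lra.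
have [s [y wE]] : exists s y, w = col_mx s%:M y.
  by exists (usubmx w 0 0), (dsubmx w); rewrite -mx11_scalar vsubmxK.
split=> [|i|i].
(* Enlarging nonnegative slopes to their slacks can only increase the norm. *)
- have sy : norm2 (quad_slopes x) <= norm2 y.
    apply: ler_norm2 => l; rewrite quad_slopes_ge0 /=.
    have := hw (inl (inl (inl (inr l)))).
    by rewrite quad_leP wE dotNl slackE dot0l mxE; lra.
  have := hw (inl (inl (inl (inl tt)))); have := hw (inl (inl (inr tt))).
  rewrite cone_leP quad_leP wE mul0mx mul_row_col mul0mx mul1mx !add0r.
  rewrite !dotNl !s0E dot0l dot_quad_affine; lra.
- have := hw (inr i); rewrite cone_leP mul0mx addr0 dot_row dot0l.
  by rewrite [(_ + q) i 0]mxE; lra.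
- have := hw (inl (inr i)); rewrite affine_leP dotNl dot_delta dot0l; lra.
Qed.

End RobustCounterpart.

Theorem proposition3p8 (R : realType) (n L : nat) (q : 'cV[R]_n)
    (M : 'I_L.+1 -> 'M[R]_n)
    (hM : forall l, psd (2^-1 *: (M l + (M l)^T)))
    (U : set 'cV[R]_L)
    (hU : U = @ball_oo R L \/ U = @ball_1 R L \/ U = @ball_2 R L) :
  admits_tractable_robust_counterpart (robust_feasible M q U).
Proof.
have mono l : monotone_mx (M l).
  by move=> x; rewrite -dot_mulmx_sym; case: (hM l).
case: hU => [|[]] ->.
- exact: counterpart_ball_oo.
- exact: counterpart_ball_1.
- exact: counterpart_ball_2.
Qed.
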